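(* Let $p$ be an odd prime and let $r,s \geq 1$ be integers. Let $L/K$ be an extension of number fields with $[L:K]=p^{s}$ and $L \subseteq \mathbb{Q}(\zeta_{p^{r+s}})$. Then $L/K$ is Leopoldt, i.e. $\mathcal{O}_L$ is a free module over the associated order $\mathcal{A}_{L/K}$.
   Context: For an integer $n\ge 1$, $\zeta_n$ denotes a primitive $n$-th root of unity and $\mathbb{Q}(\zeta_n)$ is the $n$-th cyclotomic field. For a finite Galois extension of number fields $L/K$ with group $G$, the associated order is $\mathcal{A}_{L/K}=\{x\in K[G] : x(\mathcal{O}_L)\subseteq \mathcal{O}_L\}$, where $K[G]$ acts on $L$ in the obvious way. An extension $L/K$ of number fields with $L/\mathbb{Q}$ abelian is called Leopoldt if $\mathcal{O}_L$ is a free $\mathcal{A}_{L/K}$-module (necessarily of rank 1). *)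

(* Defs.v *)
From HB Require Import structures.
From mathcomp Require Import all_boot all_order all_algebra.
From mathcomp Require Import all_fingroup all_solvable all_field.

Set Implicit Arguments.
Unset Strict Implicit.
Unset Printing Implicit Defensive.

Import GRing.Theory.
Local Open Scope ring_scope.

(* All number fields are subfields of one ambient finite normal extension M   *)
(* of the rationals, so that 'Gal(E / K) is available.                        *)
Section Leopoldt.

Variable M : splittingFieldType rat.

Definition ring_of_integers (E : {subfield M}) (x : M) : Prop :=
  x \in E /\ integralOver (intr : int -> M) x.

Section AssociatedOrder.

Variables K E : {subfield M}.

(* The group algebra K[G], G = 'Gal(E / K), by coefficient families. Only its *)
(* additive group and its action on E enter into the definition of freeness   *)
(* of a module, so its (convolution) product is not needed.                   *)
Definition group_algebra : Type :=
  {ffun subg_of 'Gal(E / K)%G -> subvs_of K}.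

Definition ga_act (a : group_algebra) (x : M) : M :=
  \sum_(g : subg_of 'Gal(E / K)%G) vsval (a g) * (sgval g : gal_of E) x.

Definition associated_order (a : group_algebra) : Prop :=
  forall x, ring_of_integers E x -> ring_of_integers E (ga_act a x).

Definition integers_basis (n : nat) (e : 'I_n -> M) : Prop :=
  (forall i, ring_of_integers E (e i)) /\
  (forall x, ring_of_integers E x ->
     exists! a : {ffun 'I_n -> group_algebra},
       (forall i, associated_order (a i)) /\ x = \sum_i ga_act (a i) (e i)).

(* The integers of E are finitely generated over Z, so a basis of them is     *)
(* necessarily finite.                                                        *)
Definition leopoldt : Prop :=
  exists (n : nat) (e : 'I_n -> M), integers_basis e.

End AssociatedOrder.

End Leopoldt.

(* Main.v *)
Require Import Defs.
From HB Require Import structures.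
From mathcomp Require Import all_boot all_order all_algebra.
From mathcomp Require Import all_fingroup all_solvable all_field.
From mathcomp Require Import ring zify.

(* Adjoining a primitive p-th root of unity to L and K gives cyclotomic fields
   F = Q(z), with z of order p^(k + s), and F0 = Q(z^(p^s)); the Galois group of
   F / F0 restricts isomorphically onto that of L / K.

   The integers of F are Z[z].  Declare the exponents i and j equivalent when
   they agree modulo p^w(j), w(j) = min(s, v_p(j) + k).  The span of the powers
   of z over a class is cut out by an idempotent of F0[G] which preserves Z[z],
   and a power in the class is carried to any other one either by an element of
   G or by multiplication by a power of z in F0.  Hence the sum x of one power
   of z per class generates the integers of F over their associated order, and
   freely so.

   Classes can be represented by a set of exponents stable under the (p - 1)-th
   roots of 1 modulo p^(k + s), and then x lies in L.  For an integer y of L, the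
   uniqueness of a in a x = y makes the coefficients of a invariant under
   Gal(F / L), so they lie in the intersection of F0 and L, which is K. *)

Set Implicit Arguments.
Unset Strict Implicit.
Unset Printing Implicit Defensive.

(** * Classes of exponents modulo powers of p *)

Lemma eqn_modW d d' a b : d' %| d -> a = b %[mod d] -> a = b %[mod d'].
Proof. by move=> dv e; rewrite -(modn_dvdm a dv) e modn_dvdm. Qed.

Lemma eq_modnM d a a' b b' :
  a = a' %[mod d] -> b = b' %[mod d] -> a * b = a' * b' %[mod d].
Proof. by move=> ea eb; rewrite -modnMm ea eb modnMm. Qed.

Lemma eq_modnX d a b n : a = b %[mod d] -> a ^ n = b ^ n %[mod d].
Proof. by move=> e; rewrite -modnXm e modnXm. Qed.

Lemma eq_modn1M d a b : a = 1 %[mod d] -> a * b = b %[mod d].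
Proof. by move=> e; rewrite -modnMml e modnMml mul1n. Qed.

Section Classes.

Variable p : nat.
Hypothesis p_pr : prime p.

Let p_gt0 := prime_gt0 p_pr.
Let p_gt1 := prime_gt1 p_pr.

(** The cofactor of [a - b] in [a ^ p - b ^ p] is a sum of [p] terms, each congruent to [b ^ p.-1]
    modulo [p], so it supplies one more factor [p]. *)
Lemma expn_prime_lift i a b :
  a = b %[mod p ^ i.+1] -> a ^ p = b ^ p %[mod p ^ i.+2].
Proof.
wlog leba : a b / b <= a.
  by move=> W e; case/orP: (leq_total b a) => /W; [apply | move=> ->].
move=> /eqP; rewrite eqn_mod_dvd // => dvab.
apply/eqP; rewrite eqn_mod_dvd ?leq_exp2r // subn_exp expnSr dvdn_mul //.
have eab : a = b %[mod p].
  by apply/eqP; rewrite eqn_mod_dvd // (dvdn_trans _ dvab) // expnS dvdn_mulr.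
suff: \sum_(l < p) a ^ (p.-1 - l) * b ^ l = p * b ^ p.-1 %[mod p].
  by rewrite modnMr => /eqP.
have -> : p * b ^ p.-1 = \sum_(l < p) b ^ p.-1.
  by rewrite sum_nat_const card_ord.
elim/big_ind2: _ => // [a1 a2 b1 b2 e1 e2 | l _].
  by rewrite -modnDm e1 e2 modnDm.
have lel : l <= p.-1 by rewrite -ltnS prednK.
rewrite -{2}(subnK lel) expnD.
by apply: eq_modnM => //; apply: eq_modnX.
Qed.

Lemma expn_prime_power_lift m a b :
  a = b %[mod p] -> a ^ (p ^ m) = b ^ (p ^ m) %[mod p ^ m.+1].
Proof.
move=> e; elim: m => [|m IHm]; first by rewrite !expn1.
by rewrite [X in a ^ X]expnSr [X in b ^ X]expnSr !expnM; apply: expn_prime_lift.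
Qed.

Local Notation unitp i := (i %/ p ^ logn p i).

Lemma unitpK i : p ^ logn p i * unitp i = i.
Proof. by rewrite mulnC divnK // pfactor_dvdnn. Qed.

Lemma unitp_coprime i : 0 < i -> coprime p (unitp i).
Proof.
move=> i_gt0; have [u cop Di] := pfactor_coprime p_pr i_gt0.
by rewrite {1}Di mulnK ?expn_gt0 ?p_gt0.
Qed.

(** One p-adic digit beyond the valuation fixes both the valuation and the unit part modulo [p]:
    divide the congruence by [p ^ logn p i]. *)
Lemma logn_unitp_mod c i j : 0 < i -> coprime p c ->
    j = c * i %[mod p ^ (logn p i).+1] ->
  [/\ logn p j = logn p i, 0 < j & unitp j = c * unitp i %[mod p]].
Proof.
move=> i_gt0 co_c; set v := logn p i; rewrite -{1}(unitpK i) -/v => e.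
have dvj : p ^ v %| j.
  have := eqn_modW (dvdn_exp2l p (leqnSn v)) e.
  by rewrite mulnCA modnMr => /eqP.
case/dvdnP: dvj => u Dj.
have eu : u = c * unitp i %[mod p].
  apply/eqP; rewrite -(eqn_pmul2l (_ : 0 < p ^ v)) ?expn_gt0 ?p_gt0 //.
  by rewrite !muln_modr -expnSr mulnC -Dj mulnCA; apply/eqP.
have co_u : coprime p u.
  rewrite -coprime_modr eu coprime_modr coprimeMr co_c.
  exact: unitp_coprime.
have u_gt0 : 0 < u.
  by case: u co_u {Dj eu} => //; rewrite /coprime gcdn0 gtn_eqF.
have Dlog : logn p j = v.
  rewrite Dj lognM ?expn_gt0 ?p_gt0 // pfactorK // logn_coprime //.
split=> //; first by rewrite Dj muln_gt0 u_gt0 expn_gt0 p_gt0.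
by rewrite Dlog {1}Dj mulnK ?expn_gt0 ?p_gt0.
Qed.

Variables k s : nat.
Hypothesis k_gt0 : 0 < k.

(** The test matters only at [j = 0], where [logn] returns 0 instead of infinity; for other
    multiples of [p ^ s] the minimum is [s] anyway. *)
Definition class_level j := if p ^ s %| j then s else minn s (logn p j + k).

Lemma class_level_le j : class_level j <= s.
Proof. by rewrite /class_level; case: ifP => // _; apply: geq_minl. Qed.

Lemma logn_lt_class j : ~~ (p ^ s %| j) -> logn p j < class_level j.
Proof.
move=> ndv; have j_gt0 : 0 < j by case: j ndv; rewrite ?dvdn0.
rewrite /class_level (negPf ndv) leq_min -addn1 leq_add2l k_gt0 andbT.
by rewrite addn1 ltnNge -pfactor_dvdn.
Qed.

Lemma class_level_dvd i j :
  i = j %[mod p ^ class_level j] -> (p ^ s %| i) = (p ^ s %| j).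
Proof.
move=> e; case: (boolP (p ^ s %| j)) => dvj.
  move: e; rewrite /class_level dvj => e.
  by rewrite /dvdn e -/(dvdn _ _).
have j_gt0 : 0 < j by case: j dvj {e}; rewrite ?dvdn0.
have [||Di i_gt0 _] := @logn_unitp_mod 1 j i j_gt0; first exact: coprimen1.
  by rewrite mul1n; apply: eqn_modW e; rewrite dvdn_exp2l // logn_lt_class.
by rewrite pfactor_dvdn // Di -pfactor_dvdn // (negPf dvj).
Qed.

(** Makes the relation symmetric, although its modulus is attached to one of the two exponents. *)
Lemma class_level_eq i j :
  i = j %[mod p ^ class_level j] -> class_level i = class_level j.
Proof.
move=> e; have := class_level_dvd e; rewrite /class_level => ->.
case: ifP => // /negbT dvj.
have j_gt0 : 0 < j by case: j dvj {e}; rewrite ?dvdn0.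
have [||-> //] := @logn_unitp_mod 1 j i j_gt0; first exact: coprimen1.
by rewrite mul1n; apply: eqn_modW e; rewrite dvdn_exp2l // logn_lt_class.
Qed.

Local Notation N := (p ^ (k + s)).

(* theta i is the inverse of the Teichmueller lift of the unit part of i, so
   theta i * i is unchanged when i is multiplied by a (p - 1)-th root of 1. *)
Let theta i := unitp i ^ (p ^ (k + s).-1 * p.-2).
Let theta' i := unitp i ^ (p ^ (k + s).-1).

Let m_gt0 : 0 < k + s. Proof. by rewrite addn_gt0 k_gt0. Qed.

Let theta_inv i : 0 < i -> theta i * theta' i = 1 %[mod N].
Proof.
move=> i_gt0; rewrite /theta /theta' -expnD -mulnSr.
have -> : p ^ (k + s).-1 * (p.-2).+1 = totient N.
  by rewrite totient_pfactor // mulnC prednK // -ltnS prednK.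
apply: Euler_exp_totient.
by rewrite coprime_sym coprime_pexpl // unitp_coprime.
Qed.

(** The unit part of [j] and [c] times that of [i] agree modulo [p], hence modulo [N] once raised to
    the power [p ^ (k + s).-1]. *)
Let theta_eq c i j : 0 < i -> coprime p c ->
    j = c * i %[mod p ^ (logn p i).+1] ->
  theta j = c ^ (p ^ (k + s).-1 * p.-2) * theta i %[mod N].
Proof.
move=> i_gt0 co_c /(logn_unitp_mod i_gt0 co_c)[_ _ e].
rewrite /theta !expnM -expnMn; apply: eq_modnX.
by rewrite -expnMn -{2 4}(prednK m_gt0); apply: expn_prime_power_lift.
Qed.

Let theta_class i j : ~~ (p ^ s %| j) ->
  i = j %[mod p ^ class_level j] -> theta i = theta j %[mod N].
Proof.
move=> dvj e.
have j_gt0 : 0 < j by case: j dvj {e}; rewrite ?dvdn0.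
have := @theta_eq 1 j i j_gt0 (coprimen1 _); rewrite exp1n !mul1n; apply.
by apply: eqn_modW e; rewrite dvdn_exp2l // logn_lt_class.
Qed.

(** On a class of non-multiples of [p ^ s], [theta] is a constant unit modulo [N], so multiplication
    by it maps the class bijectively onto a residue class modulo [p ^ class_level i], with exactly
    one member below that modulus; its preimage is the representative. A [(p - 1)]-th root of 1
    changes neither [theta i * i] nor the level, hence preserves the choice. Multiples of [p ^ s]
    form one class, represented by 0. *)
Lemma class_representatives : exists X : {set 'I_N},
  [/\ forall j, exists2 i : 'I_N, i \in X & i = j %[mod p ^ class_level j],
      {in X &, forall i j : 'I_N, i = j %[mod p ^ class_level j] -> i = j}
    & forall c, c ^ p.-1 = 1 %[mod N] ->
      {in X, forall i : 'I_N, exists2 j : 'I_N, j \in X & j = c * i %[mod N]}].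
Proof.
have N_gt0 : 0 < N by rewrite expn_gt0 p_gt0.
have dvW j : p ^ class_level j %| N.
  by rewrite dvdn_exp2l // (leq_trans (class_level_le j)) ?leq_addl.
pose X := [set i : 'I_N | if p ^ s %| i then i == 0 :> nat
                          else (theta i * i) %% N < p ^ class_level i].
exists X; split.
- move=> j; case: (boolP (p ^ s %| j)) => dvj.
    exists (Ordinal N_gt0); first by rewrite inE dvdn0.
    by rewrite mod0n /class_level dvj; apply/esym/eqP.
  have j_gt0 : 0 < j by case: j dvj; rewrite ?dvdn0.
  (* Multiplying by [theta' j], inverse to [theta j] modulo [N], brings the reduced value [r] back
     into the class of [j]. *)
  pose r := (theta j * j) %% p ^ class_level j.
  pose i := Ordinal (ltn_pmod (theta' j * r) N_gt0).
  have ei : i = j %[mod p ^ class_level j].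
    rewrite /= modn_dvdm // modnMmr mulnA [theta' j * _]mulnC.
    apply: eq_modn1M; exact: eqn_modW (dvW j) (theta_inv j_gt0).
  exists i => //; rewrite inE (class_level_dvd ei) (negPf dvj).
  have -> : theta i * i = r %[mod N].
    rewrite -modnMm (theta_class dvj ei) modn_mod modnMm mulnA.
    by apply: eq_modn1M; apply: theta_inv.
  rewrite (class_level_eq ei); apply: leq_ltn_trans (leq_mod _ _) _.
  by rewrite ltn_pmod ?expn_gt0 ?p_gt0.
- move=> i j; rewrite !inE => Xi Xj e; rewrite (class_level_dvd e) in Xi.
  case: ifP Xi Xj => [_ /eqP i0 /eqP j0|/negbT dvj].
    by apply/val_inj; rewrite /= i0 j0.
  have j_gt0 : 0 < j by case: (j : nat) dvj; rewrite ?dvdn0.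
  rewrite (class_level_eq e) => lti ltj.
  have eth : theta j * i = theta j * j %[mod N].
    have -> : theta j * i = theta i * i %[mod N].
      by apply: eq_modnM => //; rewrite (theta_class dvj e).
    rewrite -(modn_small lti) -[RHS](modn_small ltj) !modn_dvdm //.
    by apply: eq_modnM => //; apply: eqn_modW (dvW j) (theta_class dvj e).
  apply/val_inj; rewrite /= -(modn_small (ltn_ord i)) -(modn_small (ltn_ord j)).
  have thK a : theta' j * (theta j * a) = a %[mod N].
    by rewrite mulnA [theta' j * _]mulnC; apply/eq_modn1M/theta_inv.
  by rewrite -(thK i) -(thK j); apply: eq_modnM.
move=> c c1 i; rewrite inE => Xi.
have co_c : coprime p c.
  have : coprime p (c ^ p.-1).
    rewrite -(coprime_pexpl _ _ m_gt0) -coprime_modr c1 coprime_modr.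
    exact: coprimen1.
  by rewrite coprime_pexpr // -ltnS prednK.
pose j := Ordinal (ltn_pmod (c * i) N_gt0).
have ej : j = c * i %[mod N] by rewrite /= modn_mod.
exists j => //; rewrite inE.
case: ifP Xi => [_ /eqP i0|/negbT dvi lti].
  by rewrite /= i0 muln0 mod0n dvdn0.
have i_gt0 : 0 < i by case: (i : nat) dvi; rewrite ?dvdn0.
have lev : logn p i < k + s.
  apply: leq_trans (logn_lt_class dvi) _.
  by rewrite (leq_trans (class_level_le i)) ?leq_addl.
have ej' : j = c * i %[mod p ^ (logn p i).+1].
  by apply: eqn_modW ej; rewrite dvdn_exp2l.
have [Dlog j_gt0 _] := logn_unitp_mod i_gt0 co_c ej'.
have dvj : (p ^ s %| j) = false.
  by rewrite pfactor_dvdn // Dlog -pfactor_dvdn // (negPf dvi).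
have Dlev : class_level j = class_level i.
  by rewrite /class_level dvj (negPf dvi) Dlog.
rewrite dvj Dlev.
suff -> : theta j * j = theta i * i %[mod N] by [].
(* The exponent [p ^ (k + s).-1 * p.-2 + 1] is a multiple of [p.-1], because powers of [p] are 1
   modulo [p.-1]. *)
have ec : c ^ (p ^ (k + s).-1 * p.-2) * c = 1 %[mod N].
  have [d Dd] : exists d, p ^ (k + s).-1 * p.-2 + 1 = d * p.-1.
    have [f Df] : exists f, (p ^ (k + s).-1).-1 = p.-1 * f.
      by rewrite predn_exp; eexists.
    have P_gt0 : 0 < p ^ (k + s).-1 by rewrite expn_gt0 p_gt0.
    have p2 : p.-1 = p.-2.+1 by case: (p) p_gt1 => [|[]].
    exists (1 + f * p.-2); rewrite -(prednK P_gt0) Df p2 /= -[(_ * f).+1]addn1.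
    by rewrite !(mulnDl, mulnDr, mulSn, mulnS, mul1n, mulnA, addnA) mulnC;
      clear; lia.
  by rewrite -expnSr -addn1 Dd mulnC expnM -modnXm c1 modnXm exp1n.
have -> : theta j * j = c ^ (p ^ (k + s).-1 * p.-2) * theta i * (c * i) %[mod N].
  by apply: eq_modnM => //; apply: theta_eq ej'.
by rewrite mulnACA; apply: eq_modn1M.
Qed.

End Classes.

Import Order.TTheory GRing.Theory Num.Theory.
Local Open Scope ring_scope.

(** * The integers of a cyclotomic field of prime power order *)

Section RationalIntegers.

Variable M : fieldExtType rat.

Local Notation integral := (integralOver (intr : int -> M)).

Lemma intr_alg (c : int) : c%:~R = c%:~R%:A :> M.
Proof. by rewrite -in_algE rmorph_int. Qed.

Lemma fieldExt_rat_natr_eq0 n : (n%:R == 0 :> M) = (n == 0).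
Proof.
by rewrite -(rmorph_nat (in_alg M)) fmorph_eq0 pnatr_eq0.
Qed.

Lemma fieldExt_rat_intr_inj : injective (intr : int -> M).
Proof.
by move=> a b; rewrite !intr_alg -!in_algE => /fmorph_inj/intr_inj.
Qed.

Lemma integral_sum (I : Type) (r : seq I) (P : pred I) (f : I -> M) :
  (forall i, P i -> integral (f i)) -> integral (\sum_(i <- r | P i) f i).
Proof.
move=> intf; elim/big_ind: _ => //; first exact: integral0.
exact: integral_add.
Qed.

Lemma integral_exp (x : M) n : integral x -> integral (x ^+ n).
Proof.
move=> intx; elim: n => [|n IH]; first exact: integral1.
by rewrite exprS; apply: integral_mul.
Qed.

(** Transported to [algC] by [ratr], the rational number is an algebraic integer, hence an
    integer. *)
Lemma integral_rational (x : M) :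
  x \in 1%VS -> integral x -> exists c : int, x = c%:~R.
Proof.
case/vlineP=> q ->{x} [P monP]; rewrite -in_algE => rootP.
have {}rootP: root (map_poly (intr : int -> rat) P) q.
  rewrite -(fmorph_root (in_alg M)) -map_poly_comp; congr (root _ _): rootP.
  by apply: eq_map_poly => c; symmetry; apply: (rmorph_int (in_alg M)).
have rootA: root (map_poly (intr : int -> algC) P) (ratr q).
  have -> : map_poly intr P = map_poly (ratr : rat -> algC) (map_poly intr P).
    by rewrite -map_poly_comp; apply: eq_map_poly => c; rewrite /= ratr_int.
  by rewrite fmorph_root.
have Aq: ratr q \in Aint.
  apply: root_monic_Aint rootA _ _; first by rewrite monic_map.
  by apply/polyOverP=> i; rewrite coef_map /= rpred_int.
case/intrP: (Cint_rat_Aint (Crat_rat q) Aq) => c Dc; exists c.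
rewrite in_algE intr_alg; congr (_ *: 1); apply: (fmorph_inj (@ratr algC)).
by rewrite /= Dc ratr_int.
Qed.

Lemma integral_div_prime_dvd (p : nat) (c : int) (x : M) :
  prime p -> integral x -> c%:~R = p%:R * x -> (p %| `|c|)%N.
Proof.
move=> pr_p intx Dc.
have nzp: p%:R != 0 :> M by rewrite fieldExt_rat_natr_eq0 -lt0n prime_gt0.
have /integral_rational[//|d Dx]: x \in 1%VS.
  apply/vlineP; exists (c%:~R / p%:R).
  rewrite -in_algE rmorphM rmorph_int fmorphV rmorph_nat Dc mulrC mulKf //.
have ->: c = p%:Z * d.
  by apply: fieldExt_rat_intr_inj; rewrite Dc Dx intrM.
by rewrite abszM dvdn_mulr.
Qed.

End RationalIntegers.

Section IntAdjoin.

Variables (M : fieldExtType rat) (z : M).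

Definition int_adjoin (y : M) := exists q : {poly int}, y = (map_poly intr q).[z].

Lemma int_adjoin_int c : int_adjoin c%:~R.
Proof. by exists c%:P; rewrite map_polyC hornerC. Qed.

Lemma int_adjoin_gen : int_adjoin z.
Proof. by exists 'X; rewrite map_polyX hornerX. Qed.

Lemma int_adjoinD x y : int_adjoin x -> int_adjoin y -> int_adjoin (x + y).
Proof. by case=> [q ->] [r ->]; exists (q + r); rewrite rmorphD hornerD. Qed.

Lemma int_adjoinM x y : int_adjoin x -> int_adjoin y -> int_adjoin (x * y).
Proof. by case=> [q ->] [r ->]; exists (q * r); rewrite rmorphM hornerM. Qed.

Lemma int_adjoinN x : int_adjoin x -> int_adjoin (- x).
Proof. by case=> [q ->]; exists (- q); rewrite rmorphN hornerN. Qed.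

Lemma int_adjoin_sum (I : Type) (r : seq I) (P : pred I) (f : I -> M) :
  (forall i, P i -> int_adjoin (f i)) -> int_adjoin (\sum_(i <- r | P i) f i).
Proof.
move=> intf; elim/big_ind: _ => //; first exact: (int_adjoin_int 0).
exact: int_adjoinD.
Qed.

Lemma int_adjoin_prod (I : Type) (r : seq I) (P : pred I) (f : I -> M) :
  (forall i, P i -> int_adjoin (f i)) -> int_adjoin (\prod_(i <- r | P i) f i).
Proof.
move=> intf; elim/big_ind: _ => //; first exact: (int_adjoin_int 1).
exact: int_adjoinM.
Qed.

Lemma int_adjoinX x n : int_adjoin x -> int_adjoin (x ^+ n).
Proof.
move=> Zx; elim: n => [|n IH]; first exact: (int_adjoin_int 1).
by rewrite exprS; apply: int_adjoinM.
Qed.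

Lemma int_adjoinP y : int_adjoin y ->
  exists q : {poly int}, y = \sum_(i < size q) (q`_i)%:~R * z ^+ i.
Proof.
case=> q ->; exists q; rewrite horner_coef size_map_inj_poly //.
  by apply: eq_bigr => i _; rewrite coef_map.
exact: fieldExt_rat_intr_inj.
Qed.

(** For [z] of order a power of [p], [1 - z] is a uniformizer above [p], so divisibility by [p] is
    read on expansions in its powers. *)
Lemma int_adjoin_1sub y : int_adjoin y ->
  exists q : {poly int}, y = (map_poly intr q).[1 - z].
Proof.
case=> q ->; exists (q \Po (1 - 'X)).
rewrite map_comp_poly horner_comp rmorphB rmorph1 /= map_polyX !hornerE.
by rewrite subKr.
Qed.

Lemma integral_int_adjoin y :
  integralOver intr z -> int_adjoin y -> integralOver (intr : int -> M) y.
Proof.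
move=> intz /int_adjoinP[q ->]; apply: integral_sum => i _.
by apply: integral_mul; [apply: integral_id | apply: integral_exp].
Qed.

End IntAdjoin.

(** * The cyclotomic polynomial of prime power order *)

Section PrimePowerCyclotomic.

Variables (F : fieldType) (p m : nat) (z : F).
Hypothesis p_pr : prime p.
Hypothesis prim_z : (p ^ m.+1).-primitive_root z.

(** If [x] is a primitive root of order [p ^ m.+1], then [x ^+ (p ^ m)] is a nontrivial [p]-th root
    of 1 and its geometric sum vanishes. So the cyclotomic polynomial divides the sum, and both are
    monic of the same degree. *)
Lemma cyclotomic_prime_power :
  cyclotomic z (p ^ m.+1) = \sum_(i < p) 'X^(i * p ^ m).
Proof.
have p_gt0 := prime_gt0 p_pr.
set Q := \sum_(i < p) _.
have hQ x : Q.[x] = \sum_(i < p) (x ^+ (p ^ m)) ^+ i.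
  rewrite /Q horner_sum; apply: eq_bigr => i _.
  by rewrite hornerXn mulnC exprM.
have szQ: Q = \poly_(i < (p.-1 * p ^ m).+1) (p ^ m %| i)%N%:R.
  apply/polyP=> j; rewrite coef_sum coef_poly ltnS.
  under eq_bigr do rewrite coefXn.
  have pm_gt0: (0 < p ^ m)%N by rewrite expn_gt0 p_gt0.
  case: (boolP (p ^ m %| j)%N) => [/dvdnP[i ->]|ndv]; last first.
    rewrite if_same big1 // => i _; case: eqP => // Dj.
    by rewrite Dj dvdn_mull in ndv.
  rewrite leq_pmul2r // -ltnS prednK //; case: ltnP => [lti|gei].
    rewrite (bigD1 (Ordinal lti)) //= eqxx big1 ?addr0 // => k nek.
    rewrite eqn_pmul2r //; case: eqP => // Di; case/eqP: nek; exact/val_inj.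
  rewrite big1 // => k _; rewrite eqn_pmul2r //; case: eqP => // Di.
  by have := ltn_ord k; rewrite -Di ltnNge gei.
have lQ: Q`_(p.-1 * p ^ m) = 1 by rewrite szQ coef_poly ltnSn dvdn_mull.
have sQ: size Q = (p.-1 * p ^ m).+1.
  apply/eqP; rewrite eqn_leq {1}szQ size_poly ltnNge.
  by apply/negP=> /leq_sizeP/(_ _ (leqnn _))/eqP; rewrite lQ oner_eq0.
have mQ: Q \is monic by rewrite monicE lead_coefE sQ lQ.
apply/eqP; rewrite -eqp_monic ?cyclotomic_monic //.
rewrite -dvdp_size_eqp.
  by rewrite size_cyclotomic sQ totient_pfactor.
have -> : cyclotomic z (p ^ m.+1) = \prod_(x <- [seq z ^+ i |
    i : 'I_(p ^ m.+1) in [pred i : 'I__ | coprime i (p ^ m.+1)]]) ('X - x%:P).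
  by rewrite big_image.
apply: uniq_roots_dvdp; last first.
  rewrite uniq_rootsE map_inj_in_uniq ?enum_uniq // => i j _ _ /eqP.
  rewrite (eq_prim_root_expr prim_z) !modn_small // => /eqP.
  exact: val_inj.
apply/allP=> x /imageP[[k ltk] /=]; rewrite inE /= => co_k ->.
apply/rootP; rewrite hQ; move: co_k {ltk} => co_k.
set w := _ ^+ _; have w1: w != 1.
  rewrite /w -exprM -(prim_order_dvd prim_z) expnS dvdn_pmul2r ?expn_gt0 ?p_gt0 //.
  by rewrite -prime_coprime // coprime_sym; rewrite coprime_pexpr in co_k.
apply: (mulfI (_ : w - 1 != 0)); first by rewrite subr_eq0.
rewrite mulr0 -subrX1 /w -!exprM -expnSr mulnC exprM.
by rewrite (prim_expr_order prim_z) expr1n subrr.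
Qed.

Lemma prod_1_sub_prim_root :
  \prod_(k < p ^ m.+1 | coprime k (p ^ m.+1)) (1 - z ^+ k) = p%:R.
Proof.
transitivity (cyclotomic z (p ^ m.+1)).[1].
  rewrite horner_prod; apply: eq_bigr => k _; by rewrite !hornerE.
rewrite cyclotomic_prime_power horner_sum -[in RHS](card_ord p) -sumr_const.
by apply: eq_bigr => i _; rewrite hornerXn expr1n.
Qed.

End PrimePowerCyclotomic.

(** * Total ramification of p and the ring Z[z] *)

Section CyclotomicUnit.

Variables (M : fieldExtType rat) (p m : nat) (z : M).
Hypothesis p_pr : prime p.
Hypothesis prim_z : (p ^ m.+1).-primitive_root z.

Local Notation N := (p ^ m.+1)%N.
Local Notation phi := (totient N).
Local Notation integral := (integralOver (intr : int -> M)).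

Lemma integral_prim_root : integral z.
Proof.
exists ('X^N - 1); first by rewrite -polyC1 monicXnsubC ?(prim_order_gt0 prim_z).
apply/rootP; rewrite rmorphB rmorph1 /= map_polyXn !hornerE.
by rewrite prim_expr_order // subrr.
Qed.

Lemma int_adjoin_root_exp k : int_adjoin z (z ^+ k).
Proof. exact/int_adjoinX/int_adjoin_gen. Qed.

Lemma int_adjoin_1sub_ratio i j :
  exists2 a, int_adjoin z a & 1 - z ^+ (j * i) = a * (1 - z ^+ i).
Proof.
exists (\sum_(l < j) z ^+ (i * l)).
  by apply: int_adjoin_sum => l _; apply: int_adjoin_root_exp.
rewrite mulnC exprM mulrC -opprB -[1 - _ ^+ i]opprB mulNr subrX1.
by congr (- (_ * _)); apply: eq_bigr => l _; rewrite exprM.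
Qed.

(** For [k] coprime to [N], [1 - z] and [1 - z ^+ k] divide each other in Z[z], and the product of
    the [1 - z ^+ k] is [p]. *)
Lemma ramified_prime : exists u v,
  [/\ int_adjoin z u, int_adjoin z v, u * v = 1 & (1 - z) ^+ phi = p%:R * u].
Proof.
have N_gt0 : (0 < N)%N by rewrite expn_gt0 prime_gt0.
have N_gt1 : (1 < N)%N.
  by rewrite (leq_trans (prime_gt1 p_pr)) // expnS leq_pmulr ?expn_gt0 ?prime_gt0.
have nz1z i : coprime i N -> 1 - z ^+ i != 0.
  move=> co_i; rewrite subr_eq0 eq_sym -(prim_order_dvd prim_z).
  apply/negP=> dvN; have := coprime_dvdl dvN co_i.
  by rewrite /coprime gcdnn gtn_eqF.
have Dpi : (1 - z) ^+ phi = \prod_(k < N | coprime k N) (1 - z).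
  rewrite prodr_const; congr (_ ^+ _).
  rewrite totient_count_coprime -big_mkcond big_mkord -sum1_card.
  by apply: eq_bigl => k; rewrite coprime_sym.
pose u := \prod_(k < N | coprime k N) ((1 - z) / (1 - z ^+ k)).
pose v := \prod_(k < N | coprime k N) ((1 - z ^+ k) / (1 - z)).
have nz1 : 1 - z != 0 by rewrite -[z in 1 - z]expr1 nz1z ?coprime1n.
exists u, v; split.
- apply: int_adjoin_prod => k co_k.
  (* With [k'] inverse to [k] modulo [N], [z] is a power of [z ^+ k], so [1 - z ^+ k] divides
     [1 - z]. *)
  have [k' Dk'] : exists k', (k' * k = 1 %[mod N])%N.
    exists (egcdn k N).1; case: egcdnP => [|a b Dab _] /=.
      by case: (k : nat) co_k => //; rewrite /coprime gcd0n gtn_eqF.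
    by rewrite Dab (eqP co_k) modnMDl.
  have [a Za Da] := int_adjoin_1sub_ratio k k'.
  suff ->: (1 - z) / (1 - z ^+ k) = a by [].
  apply: canLR (mulfK (nz1z _ co_k)) _; rewrite -Da; congr (1 - _).
  by apply/eqP; rewrite -{1}[z]expr1 (eq_prim_root_expr prim_z) eq_sym; apply/eqP.
- apply: int_adjoin_prod => k co_k.
  have [a Za Da] := int_adjoin_1sub_ratio 1 k.
  suff ->: (1 - z ^+ k) / (1 - z) = a by [].
  by rewrite -[k : nat]muln1 Da expr1 mulfK.
- rewrite /u /v -big_split big1 //= => k co_k.
  by rewrite mulrA mulfVK ?nz1z // mulfV.
rewrite Dpi /u -(prod_1_sub_prim_root p_pr prim_z) -big_split.
by apply: eq_bigr => k co_k; rewrite /= mulrC mulfVK ?nz1z.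
Qed.

(* Multiplying by (1 - z)^(phi - 1 - j) pushes every term of index > j into
   (1 - z)^phi, an associate of p. *)
Lemma coef_dvd_prime (q : {poly int}) (w : M) :
    (size q <= phi)%N -> integral w -> (map_poly intr q).[1 - z] = p%:R * w ->
  forall j, (p %| `|(q`_j)%R|)%N.
Proof.
move=> szq intw Dq j; elim/ltn_ind: j => j IHj.
have [ltj|gej] := ltnP j phi; last by rewrite nth_default // (leq_trans szq).
have phi_gt0 : (0 < phi)%N := leq_ltn_trans (leq0n _) ltj.
have lej : (j <= phi.-1)%N by rewrite -ltnS prednK.
have [u [v [Zu Zv uv1 Dpi]]] := ramified_prime.
have Z1z : int_adjoin z (1 - z).
  apply: int_adjoinD; first exact: (int_adjoin_int _ 1).
  exact/int_adjoinN/int_adjoin_gen.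
have int1z := integral_int_adjoin integral_prim_root Z1z.
have intu := integral_int_adjoin integral_prim_root Zu.
have intv := integral_int_adjoin integral_prim_root Zv.
have nzp: p%:R != 0 :> M by rewrite fieldExt_rat_natr_eq0 -lt0n prime_gt0.
(* Modulo [p] only the term of index [j] survives: earlier coefficients are divisible by [p] by
   induction, later terms contain [(1 - z) ^+ phi]. *)
have [w1 intw1 Dw1] : exists2 w1 : M, integral w1 &
    (q`_j)%:~R * (1 - z) ^+ phi.-1 = p%:R * w1.
  have Dqs : (map_poly intr q).[1 - z] = \sum_(i < phi) (q`_i)%:~R * (1 - z) ^+ i.
    rewrite (horner_coef_wide _ (_ : _ <= phi)%N).
      by apply: eq_bigr => i _; rewrite coef_map.
    by rewrite size_map_inj_poly //; apply: fieldExt_rat_intr_inj.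
  rewrite Dqs (bigD1 (Ordinal ltj)) //= in Dq.
  have {Dq} := congr1 ( *%R ((1 - z) ^+ (phi.-1 - j))) Dq.
  rewrite mulrDr mulrCA -exprD subnK //.
  set T := (X in _ + X) => /(canRL (addrK _)) ->.
  have [w2 intw2 ->]: exists2 w2, integral w2 & T = p%:R * w2.
    rewrite {}/T mulr_sumr.
    apply: (big_ind (fun t => exists2 w2, integral w2 & t = p%:R * w2)).
    + by exists 0; rewrite ?mulr0 //; apply: integral0.
    + move=> _ _ [a inta ->] [b intb ->]; exists (a + b); rewrite ?mulrDr //.
      exact: integral_add.
    move=> i neij; have [ltij|geij] := ltnP i j.
      have /dvdnP[d Dd] := IHj i ltij.
      exists ((sgz q`_i * d%:Z)%:~R * (1 - z) ^+ (phi.-1 - j) * (1 - z) ^+ i).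
        do 2?[apply: integral_mul; last exact: integral_exp].
        exact: integral_id.
      rewrite {1}[q`_i]intEsg Dd PoszM !intrM.
      move: (sgz _)%:~R d%:Z%:~R ((1 - z) ^+ (_ - j)) ((1 - z) ^+ i) => a b c e.
      by rewrite -pmulrn; ring.
    have ltji : (j < i)%N.
      rewrite ltn_neqAle geij andbT; apply: contraNneq neij => Dj.
      by apply/eqP/val_inj; rewrite /= Dj.
    exists (u * (q`_i)%:~R * (1 - z) ^+ (i - j.+1)).
      apply: integral_mul; last exact: integral_exp.
      by apply: integral_mul => //; apply: integral_id.
    rewrite !mulrA -Dpi [LHS]mulrAC [RHS]mulrAC -!exprD; congr (_ ^+ _ * _).
    by clear -lej phi_gt0 ltji; lia.
  exists ((1 - z) ^+ (phi.-1 - j) * w - w2).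
    by apply: integral_sub => //; apply: integral_mul => //; apply: integral_exp.
  by rewrite mulrBr mulrCA.
(* One more factor [1 - z] produces [(1 - z) ^+ phi = p%:R * u] on the left; cancel [p] and invert
   [u]. *)
have Dj : (q`_j)%:~R = v * w1 * (1 - z).
  have := congr1 ( *%R^~ (1 - z)) Dw1.
  rewrite -!mulrA -exprSr prednK // Dpi mulrCA.
  move/(mulfI nzp) => /(congr1 ( *%R v)); rewrite mulrCA [v * u]mulrC uv1 mulr1.
  by move->; rewrite !mulrA.
(* The power [phi] turns divisibility by [1 - z] into divisibility by [p], which descends to the
   integers. *)
have: (p %| `|(q`_j ^+ phi)%R|)%N.
  apply: (@integral_div_prime_dvd M p _ ((v * w1) ^+ phi * u)) => //.
    apply: integral_mul => //; apply: integral_exp; exact: integral_mul.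
  by rewrite rmorphXn /= Dj exprMn Dpi mulrCA.
by rewrite abszX Euclid_dvdX // => /andP[].
Qed.

(** Expand [p%:R * w] in powers of [1 - z]. The part of degree at least [phi] is [p] times an
    element of Z[z]; the rest has at most [phi] coefficients, all divisible by [p] by
    [coef_dvd_prime]. *)
Lemma int_adjoin_saturated w :
  integral w -> int_adjoin z (p%:R * w) -> int_adjoin z w.
Proof.
move=> intw /int_adjoin_1sub[q Dq].
have [u [v [Zu Zv uv1 Dpi]]] := ramified_prime.
have Z1z : int_adjoin z (1 - z).
  apply: int_adjoinD; first exact: (int_adjoin_int _ 1).
  exact/int_adjoinN/int_adjoin_gen.
have nzp: p%:R != 0 :> M by rewrite fieldExt_rat_natr_eq0 -lt0n prime_gt0.
have Zpoly (r : {poly int}) : int_adjoin z (map_poly intr r).[1 - z].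
  rewrite horner_coef; apply: int_adjoin_sum => i _; rewrite coef_map.
  by apply: int_adjoinM; [apply: int_adjoin_int | apply: int_adjoinX].
pose t := u * (map_poly intr (drop_poly phi q)).[1 - z].
have Zt : int_adjoin z t by apply: int_adjoinM.
have Dtake : (map_poly intr (take_poly phi q)).[1 - z] = p%:R * (w - t).
  have Dq' := congr1 (fun r => (map_poly (intr : int -> M) r).[1 - z])
    (poly_take_drop phi q).
  rewrite /= rmorphD rmorphM /= map_polyXn !hornerE Dpi -Dq in Dq'.
  by rewrite mulrBr -Dq' /t !mulrA [p%:R * u * _]mulrC mulrA addrK.
have dvq := coef_dvd_prime (size_take_poly _ _) _ Dtake.
have {}dvq := dvq (integral_sub intw (integral_int_adjoin integral_prim_root Zt)).
suff: int_adjoin z (w - t) by move/int_adjoinD/(_ Zt); rewrite subrK.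
pose q' := \poly_(i < phi) ((take_poly phi q)`_i %/ p)%Z.
suff ->: w - t = (map_poly intr q').[1 - z] by apply: Zpoly.
rewrite {}/q'; apply: (mulfI nzp); rewrite -Dtake.
have -> : p%:R = p%:Z%:~R :> M by [].
rewrite -hornerZ; congr _.[_]; apply/polyP=> i.
rewrite coefZ !coef_map coef_poly /= -intrM; congr (_%:~R).
case: ltnP => [_|gei]; last first.
  by rewrite mulr0 nth_default // (leq_trans (size_take_poly _ _)).
by rewrite mulrC divzK //; apply: dvq.
Qed.

(** The minimal polynomial divides the cyclotomic one, hence the upper bound. For the lower bound, a
    nonzero integer relation of degree below [phi] for [1 - z] would have all its coefficients
    divisible by [p], and could be divided by [p] forever. *)
Lemma dim_cyclotomic : \dim <<1; z>> = phi.
Proof.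
rewrite dim_Fadjoin dimv1 muln1; apply/eqP; rewrite eqn_leq; apply/andP; split.
  rewrite -ltnS -(size_minPoly 1 z) -(size_cyclotomic z).
  apply: dvdp_leq; first exact/monic_neq0/cyclotomic_monic.
  apply: minPoly_dvdp; last by rewrite root_cyclotomic.
  rewrite cyclotomic_prime_power //; apply: rpred_sum => i _.
  by rewrite rpredX ?polyOverX.
have -> : adjoin_degree 1 z = adjoin_degree 1 (1 - z).
  have dim_deg (x : M) : adjoin_degree 1 x = \dim <<1; x>>.
    by rewrite dim_Fadjoin dimv1 muln1.
  rewrite !dim_deg.
  suff ->: <<1; z>>%VS = <<1; 1 - z>>%VS :> {vspace M} by [].
  apply/eqP; rewrite eqEsubv; apply/andP; split; apply/FadjoinP;
    rewrite subv_adjoin /=.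
    by rewrite -{1}[z](subKr 1) rpredB ?memv_adjoin // (subvP (subv_adjoin _ _)) ?mem1v.
  by rewrite rpredB ?memv_adjoin // (subvP (subv_adjoin _ _)) ?mem1v.
rewrite leqNgt; apply/negP=> lt_deg.
have /polyOver1P[P DP] := minPolyOver 1 (1 - z).
have [q [a nza Dq]] := rat_poly_scale P.
have q_root : (map_poly intr q).[1 - z] = 0 :> M.
  have := minPolyxx 1 (1 - z); rewrite DP Dq map_polyZ hornerZ.
  move/eqP; rewrite mulf_eq0 fmorph_eq0 invr_eq0 intr_eq0 (negPf nza) /=.
  rewrite -map_poly_comp => /eqP <-; congr _.[_].
  by apply: eq_map_poly => c; symmetry; apply: (rmorph_int (in_alg M)).
have szq : (size q <= phi)%N.
  rewrite -size_rat_int_poly -(size_scale _ (_ : a%:~R^-1 != 0)) ?invr_eq0 ?intr_eq0 //.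
  by rewrite -Dq -(size_map_poly (in_alg M)) -DP size_minPoly.
have nzq : q != 0.
  apply: contraTneq (monic_neq0 (monic_minPoly 1 (1 - z))) => q0.
  by rewrite DP Dq q0 !rmorph0 scaler0 rmorph0 eqxx.
have nzp: p%:R != 0 :> M by rewrite fieldExt_rat_natr_eq0 -lt0n prime_gt0.
(* Infinite descent on the absolute value of the leading coefficient. *)
have [e] := ubnP `|lead_coef q|%N.
elim: e q szq nzq q_root {Dq} => // e IHe q szq nzq q_root lt_e.
have dvq := @coef_dvd_prime q 0 szq (integral0 _) _.
rewrite mulr0 in dvq; have {}dvq := dvq q_root.
pose q' := \poly_(i < size q) (q`_i %/ p)%Z.
have Dq' : q = p%:Z *: q'.
  apply/polyP=> i; rewrite coefZ coef_poly; case: ltnP => [_|gei]; last first.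
    by rewrite mulr0 nth_default.
  by rewrite mulrC divzK //; apply: dvq.
have nzpZ : p%:Z != 0 by rewrite -lt0n prime_gt0.
have nzq' : q' != 0 by apply: contraNneq nzq => q'0; rewrite Dq' q'0 scaler0.
apply: (IHe q') => //.
- exact: leq_trans (size_poly _ _) szq.
- move: q_root; rewrite Dq' map_polyZ hornerZ => /eqP.
  by rewrite mulf_eq0 (negPf nzp) => /eqP.
move: lt_e; rewrite Dq' lead_coefZ abszM ltnS; apply: leq_trans.
by rewrite ltn_Pmull ?prime_gt1 // absz_gt0 lead_coef_eq0.
Qed.

End CyclotomicUnit.

Lemma integral_aut (M : splittingFieldType rat) (f : 'AEnd(M)) (x : M) :
  integralOver (intr : int -> M) x -> integralOver (intr : int -> M) (f x).
Proof.
case=> P monP rootP; exists P => //; rewrite -(fmorph_root f) in rootP.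
congr (root _ _): rootP; rewrite -map_poly_comp; apply: eq_map_poly => c.
exact: (rmorph_int f).
Qed.

Lemma sum_expr_root_neq1 (F : fieldType) (w : F) n :
  w ^+ n = 1 -> w != 1 -> \sum_(i < n) w ^+ i = 0.
Proof.
move=> wn w1; apply: (mulfI (_ : w - 1 != 0)); first by rewrite subr_eq0.
by rewrite -subrX1 wn subrr mulr0.
Qed.

(** * Galois theory and integers of prime power cyclotomic fields *)

Section CyclotomicGalois.

Variables (M : splittingFieldType rat) (p m : nat) (z : M).
Hypothesis p_pr : prime p.
Hypothesis prim_z : (p ^ m.+1).-primitive_root z.

Local Notation N := (p ^ m.+1)%N.
Local Notation E := <<1%AS; z>>%AS.

Lemma minPoly_cyclotomic : minPoly 1 z = cyclotomic z N.
Proof.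
apply/eqP; rewrite -eqp_monic ?monic_minPoly ?cyclotomic_monic // -dvdp_size_eqp.
  rewrite size_cyclotomic size_minPoly eqSS -(dim_cyclotomic p_pr prim_z).
  by rewrite dim_Fadjoin dimv1 muln1.
apply: minPoly_dvdp; last by rewrite root_cyclotomic.
rewrite cyclotomic_prime_power //; apply: rpred_sum => i _.
by rewrite rpredX ?polyOverX.
Qed.

Lemma galois_cyclotomic : galois 1 E.
Proof.
apply/splitting_galoisField; exists (cyclotomic z N).
pose r := [seq z ^+ i | i : 'I_N in [pred i : 'I__ | coprime i N]].
have Dr : cyclotomic z N = \prod_(x <- r) ('X - x%:P) by rewrite big_image.
split; first by rewrite -minPoly_cyclotomic minPolyOver.
  rewrite Dr separable_prod_XsubC map_inj_in_uniq ?enum_uniq // => i j _ _ /eqP.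
  rewrite (eq_prim_root_expr prim_z) !modn_small // => /eqP.
  exact: val_inj.
exists r; first by rewrite -Dr eqpxx.
have Er i : z ^+ i \in <<1; z>>%VS by rewrite rpredX ?memv_adjoin.
apply/eqP; rewrite eqEsubv; apply/andP; split.
  by apply/Fadjoin_seqP; split; [apply: sub1v | move=> _ /imageP[i _ ->]].
apply/FadjoinP; split; first exact: sub1v.
by rewrite seqv_sub_adjoin // -root_prod_XsubC -Dr root_cyclotomic.
Qed.

Lemma gal_prim_root (f : gal_of E) : exists2 c, coprime c N & f z = z ^+ c.
Proof.
have prim_fz : N.-primitive_root (f z) by rewrite fmorph_primitive_root.
have [c Dc] := prim_rootP prim_z (prim_expr_order prim_fz).
by exists c => //; rewrite -(prim_root_exp_coprime _ prim_z) -Dc.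
Qed.

Lemma gal_cyclotomic_exists c : coprime c N ->
  exists2 f : gal_of E, f \in 'Gal(E / 1)%g & f z = z ^+ c.
Proof.
move=> co_c; have [_ _ nE] := and3P galois_cyclotomic.
apply: normalField_root_minPoly => //; first exact: sub1v.
  exact: memv_adjoin.
by rewrite minPoly_cyclotomic root_cyclotomic // prim_root_exp_coprime.
Qed.

Lemma gal1E (f : gal_of E) : f \in 'Gal(E / 1)%g.
Proof. by rewrite gal_kHom ?sub1v // k1AHom. Qed.

Lemma gal_cyclotomic_eq (f g : gal_of E) : f z = g z -> f = g.
Proof. by move=> e; apply/eqP; rewrite gal_adjoin_eq ?gal1E // e. Qed.

Lemma gal_cyclotomicC (f g : gal_of E) : (f * g = g * f)%g.
Proof.
apply: gal_cyclotomic_eq; rewrite !galM ?memv_adjoin //.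
have [[c _ fz] [d _ gz]] := (gal_prim_root f, gal_prim_root g).
by rewrite fz gz !rmorphXn /= fz gz -!exprM mulnC.
Qed.

(** The group of [E] over the rationals is abelian, so every subfield of [E] is Galois over them. *)
Lemma galois_sub_cyclotomic (K L : {subfield M}) :
  (K <= L)%VS -> (L <= E)%VS -> galois K L.
Proof.
move=> sKL sLE.
have galLE : galois L E by apply: galoisS galois_cyclotomic; rewrite sub1v.
suff: galois 1 L by apply: galoisS; rewrite sub1v.
have nsG : ('Gal(E / L) <| 'Gal(E / 1))%g.
  rewrite -sub_abelian_normal ?galS ?sub1v //.
  by apply/centsP=> f _ g _; apply: gal_cyclotomicC.
have := normal_fixedField_galois galois_cyclotomic nsG.
by rewrite /galois (galois_fixedField galLE).
Qed.

(** By orthogonality [N%:R * y] is the sum of the [T i * z ^+ i], where the trace [T i] of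
    [y * z^-1 ^+ i] is a rational integer; [int_adjoin_saturated] then removes the factors [p] one
    at a time. *)
Lemma integral_cyclotomic y :
  y \in E -> integralOver (intr : int -> M) y -> int_adjoin z y.
Proof.
move=> Ey inty.
have N_gt0 : (0 < N)%N by rewrite expn_gt0 prime_gt0.
have nzz : z != 0 by rewrite (prim_root_eq0 prim_z) -lt0n.
have Ez := memv_adjoin 1 z.
have intz := integral_prim_root prim_z.
have zV : z^-1 = z ^+ N.-1.
  by apply: (mulfI nzz); rewrite mulfV // -exprS prednK // prim_expr_order.
have: int_adjoin z (N%:R * y).
  pose T i := galTrace 1 E (y * z^-1 ^+ i).
  have -> : N%:R * y = \sum_(i < N) T i * z ^+ i.
    (* The inner sum is geometric in an [N]-th root of 1, which differs from 1 unless [f] is the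
       identity. *)
    transitivity (\sum_(f in 'Gal(E / 1)%g) f y * \sum_(i < N) ((f z)^-1 * z) ^+ i).
      rewrite (bigD1 1%g) ?group1 //= !gal_id mulVf //.
      rewrite (eq_bigr (fun=> 1)) => [|i _]; last by rewrite expr1n.
      rewrite sumr_const card_ord mulrC big1 ?addr0 // => f /andP[_ f1].
      rewrite sum_expr_root_neq1 ?mulr0 //.
        rewrite exprMn exprVn -rmorphXn (prim_expr_order prim_z) rmorph1.
        by rewrite invr1 mulr1.
      apply: contraNneq f1 => fz1; apply/eqP/gal_cyclotomic_eq.
      rewrite gal_id -[RHS](mulVKf (_ : f z != 0)) ?fmorph_eq0 // fz1 mulr1.
      by [].
    under eq_bigr do rewrite mulr_sumr.
    rewrite exchange_big; apply: eq_bigr => i _; rewrite /T mulr_suml.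
    by apply: eq_bigr => f _; rewrite rmorphM rmorphXn fmorphV exprMn mulrA.
  apply: int_adjoin_sum => i _; apply: int_adjoinM; last first.
    exact: int_adjoin_root_exp.
  have [||c ->] := @integral_rational _ (T i); last exact: int_adjoin_int.
    by apply: mem_galTrace galois_cyclotomic _; rewrite rpredM ?rpredX ?rpredV.
  apply: integral_sum => f _; apply: integral_aut; apply: integral_mul => //.
  by rewrite zV; do 2!apply: integral_exp.
elim: (m.+1) => [|k IHk]; first by rewrite mul1r.
rewrite expnS natrM -mulrA => /(int_adjoin_saturated p_pr prim_z)-/(_ _)/IHk; apply.
by apply: integral_mul => //; apply: integral_nat.
Qed.

End CyclotomicGalois.

(** * A generator over the associated order *)

Section GroupAlgebraOperators.

Variables (M : splittingFieldType rat) (K F : {subfield M}).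
Hypothesis sKF : (K <= F)%VS.

Local Notation G := 'Gal(F / K)%g.

(** Coefficients are plain functions into [M], with membership in [K] imposed separately, so that
    families can be subtracted, translated and conjugated freely. *)
Definition galop (a : gal_of F -> M) (x : M) := \sum_(g in G) a g * g x.

Definition is_galop (f : M -> M) :=
  exists2 a : gal_of F -> M, (forall g, a g \in K) & {in F, f =1 galop a}.

Lemma galop_sum (I : Type) (r : seq I) (P : pred I) (a : gal_of F -> M)
    (t : I -> M) :
  galop a (\sum_(i <- r | P i) t i) = \sum_(i <- r | P i) galop a (t i).
Proof.
by rewrite exchange_big; apply: eq_bigr => g _; rewrite raddf_sum mulr_sumr.
Qed.

Lemma galopB (a b : gal_of F -> M) t :
  galop (fun g => a g - b g) t = galop a t - galop b t.
Proof. by rewrite -sumrB; apply: eq_bigr => g _; rewrite mulrBl. Qed.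

Lemma galopMfix (a : gal_of F -> M) c t :
  (forall g : gal_of F, g \in G -> g c = c) -> galop a (c * t) = c * galop a t.
Proof.
move=> fixc; rewrite mulr_sumr; apply: eq_bigr => g Gg.
by rewrite rmorphM /= fixc // mulrCA.
Qed.

Lemma galopMint (a : gal_of F -> M) (c : int) t :
  galop a (c%:~R * t) = c%:~R * galop a t.
Proof. by apply: galopMfix => g _; rewrite rmorph_int. Qed.

Lemma is_galop_scale c f : c \in K -> is_galop f -> is_galop (fun x => c * f x).
Proof.
move=> Kc [a Ka Df]; exists (fun g => c * a g) => [g|x Fx].
  by rewrite rpredM.
by rewrite Df // mulr_sumr; apply: eq_bigr => g _; rewrite mulrA.
Qed.

Lemma is_galop_sum (I : finType) (f : I -> M -> M) :
  (forall i, is_galop (f i)) -> is_galop (fun x => \sum_i f i x).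
Proof.
move=> opf.
have {opf} [a ha] : exists a : I -> gal_of F -> M, forall i,
    (forall g, a i g \in K) /\ {in F, f i =1 galop (a i)}.
  by apply: (fin_all_exists (P := fun i (b : gal_of F -> M) =>
    (forall g, b g \in K) /\ {in F, f i =1 galop b})) => i;
    case: (opf i) => b; exists b.
exists (fun g => \sum_i a i g) => [g|x Fx].
  by apply: rpred_sum => i _; case: (ha i).
rewrite (eq_bigr (fun i => galop (a i) x)) => [|i _]; last by case: (ha i) => _ ->.
by rewrite exchange_big; apply: eq_bigr => g _; rewrite mulr_suml.
Qed.

Lemma is_galop_gal (g : gal_of F) : g \in G -> is_galop g.
Proof.
move=> Gg; exists (fun h => (h == g)%:R) => [h|x Fx]; first exact: rpred_nat.
rewrite /galop (bigD1 g) //= eqxx mul1r big1 ?addr0 // => h /andP[_ /negPf->].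
by rewrite mul0r.
Qed.

Lemma is_galop_comp_gal (g : gal_of F) f :
  g \in G -> is_galop f -> is_galop (fun x => g (f x)).
Proof.
move=> Gg [a Ka Df]; exists (fun h => a (h * g^-1)%g) => [h|x Fx]; first exact: Ka.
rewrite Df // rmorph_sum [RHS](reindex_inj (mulIg g)) /=.
apply: eq_big => [h|h Gh]; first by rewrite groupMr.
by rewrite rmorphM mulgK galM //= (fixed_gal sKF Gg (Ka h)).
Qed.

(** The group is commutative and fixes the coefficients. An operator killing an element thus kills
    everything that other operators produce from it. *)
Lemma galopC (a b : gal_of F -> M) t :
    (forall g h : gal_of F, (g * h = h * g)%g) -> t \in F ->
    (forall g, g \in G -> a g \in K) -> (forall g, b g \in K) ->
  galop a (galop b t) = galop b (galop a t).
Proof.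
move=> cGG Ft Ka Kb; rewrite /galop.
transitivity (\sum_(g in G) \sum_(h in G) a g * b h * h (g t)).
  apply: eq_bigr => g Gg; rewrite rmorph_sum mulr_sumr; apply: eq_bigr => h Gh.
  by rewrite rmorphM /= (fixed_gal sKF Gg (Kb h)) -!galM // cGG mulrA.
rewrite exchange_big; apply: eq_bigr => h Gh.
rewrite rmorph_sum mulr_sumr; apply: eq_bigr => g Gg.
by rewrite rmorphM /= (fixed_gal sKF Gh (Ka g Gg)) mulrCA mulrA.
Qed.

End GroupAlgebraOperators.

(** * The extension Q(z) / Q(z^(p^s)) *)

Section RelativeCyclotomic.

Variables (M : splittingFieldType rat) (p k' s : nat) (z : M).
Hypothesis p_pr : prime p.

Local Notation k := k'.+1.
Local Notation N := (p ^ (k + s))%N.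

Hypothesis prim_z : N.-primitive_root z.

Local Notation F := <<1%AS; z>>%AS.
Local Notation K := <<1%AS; z ^+ (p ^ s)>>%AS.
Local Notation G := 'Gal(F / K)%g.
Local Notation level := (class_level p k s).

Let p_gt0 := prime_gt0 p_pr.
Let p_gt1 := prime_gt1 p_pr.
Let pX_gt0 n : (0 < p ^ n)%N. Proof. by rewrite expn_gt0 p_gt0. Qed.
Let prim_z' : (p ^ (k' + s).+1).-primitive_root z. Proof. exact: prim_z. Qed.
Let Fz i : z ^+ i \in F. Proof. by rewrite rpredX ?memv_adjoin. Qed.

Lemma sub_relative_cyclotomic : (K <= F)%VS.
Proof. by apply/FadjoinP; rewrite sub1v /= Fz. Qed.
Let sKF := sub_relative_cyclotomic.

Lemma mem_relative_base i : (p ^ s %| i)%N -> z ^+ i \in K.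
Proof. by case/dvdnP=> d ->; rewrite mulnC exprM rpredX ?memv_adjoin. Qed.

(** Multiplied by [p ^ s], the congruence holds modulo [N], so the automorphism sending [z] to
    [z ^+ c] fixes [z ^+ (p ^ s)]. *)
Lemma gal_relative_exists c : (c = 1 %[mod p ^ k])%N ->
  exists2 g : gal_of F, g \in G & g z = z ^+ c.
Proof.
move=> c1.
have co_c : coprime c N.
  rewrite coprime_pexpr // -(@coprime_pexpr k) // -coprime_modl c1.
  by rewrite coprime_modl coprime1n.
have [g Gg gz] := gal_cyclotomic_exists p_pr prim_z' co_c.
exists g => //; rewrite -sub1set galois_connection //.
apply/FadjoinP; split; first exact: sub1v.
apply/(fixedFieldP (Fz _)) => _ /set1P->; rewrite rmorphXn /= gz -exprM; apply/eqP.
have := congr1 (muln^~ (p ^ s)%N) c1; rewrite /= !muln_modl -expnD mul1n => e.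
by rewrite (eq_prim_root_expr prim_z) e.
Qed.

(** Sending [z] to [z ^+ (1 + p ^ (k + s - w) * u)] multiplies [z ^+ i] by [W ^+ (i * u)], where [W]
    has order [p ^ w]. Averaging over [u] with weights [W ^- (j * u)] retains exactly the exponents
    congruent to [j] modulo [p ^ w]. *)
Lemma class_projector j : exists2 e : M -> M, is_galop K F e &
  forall i, e (z ^+ i) = if i == j %[mod p ^ level j] then z ^+ i else 0.
Proof.
set w := level j; have lew : (w <= s)%N := class_level_le p k s j.
have wm : (w <= k + s)%N by apply: leq_trans lew (leq_addl _ _).
pose W := z ^+ (p ^ (k + s - w)).
have prim_W : (p ^ w).-primitive_root W.
  by rewrite /W expnB // dvdn_prim_root // dvdn_exp2l.
have /fin_all_exists2[h Gh hz] (u : 'I_(p ^ w)) : exists2 g : gal_of F,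
    g \in G & g z = z ^+ (1 + p ^ (k + s - w) * u).
  apply: gal_relative_exists; rewrite -addnBA //.
  by rewrite expnD -mulnA mulnC addnC modnMDl.
(* [p ^ s] divides [p ^ (k + s - w) * j]: when it does not divide [j] itself, use
   [w <= logn p j + k]. *)
have KW : W ^+ j \in K.
  rewrite -exprM mem_relative_base // /w /class_level; case: ifP => [dvj|/negbT dvj].
    by rewrite dvdn_mull.
  have j_gt0 : (0 < j)%N by rewrite lt0n; apply: contraNneq dvj => ->; rewrite dvdn0.
  apply: dvdn_trans (dvdn_mul (dvdnn _) (pfactor_dvdnn p j)).
  by rewrite -expnD dvdn_exp2l //; clear; lia.
pose f (u : 'I_(p ^ w)) (t : M) := (p ^ w)%:R^-1 * (W ^+ j) ^- u * h u t.
exists (fun t => \sum_u f u t).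
  apply: is_galop_sum => u; apply: is_galop_scale; last exact: is_galop_gal.
  by apply: rpredM; rewrite rpredV; [apply: rpred_nat | apply: rpredX].
have nzp : (p ^ w)%:R != 0 :> M by rewrite fieldExt_rat_natr_eq0 -lt0n.
have nzW n : W ^+ n != 0 by rewrite expf_neq0 // (prim_root_eq0 prim_W) -lt0n.
move=> i; transitivity
  ((p ^ w)%:R^-1 * z ^+ i * \sum_(u < p ^ w) (W ^+ i / W ^+ j) ^+ u).
  rewrite mulr_sumr; apply: eq_bigr => u _; rewrite /f (rmorphXn (h u)) /= hz.
  rewrite exprD expr1 exprMn exprM -/W expr_div_n -!exprM [(u * i)%N]mulnC.
  by rewrite mulrACA; congr (_ * _); rewrite mulrC.
case: ifP => [eij|neij].
  rewrite -(eq_prim_root_expr prim_W) in eij.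
  rewrite (eqP eij) divff ?nzW //.
  rewrite (eq_bigr (fun=> 1)) => [|u _]; last by rewrite expr1n.
  by rewrite sumr_const card_ord mulrAC mulVf ?mul1r.
rewrite [X in _ * X](_ : _ = 0) ?mulr0 //; apply: sum_expr_root_neq1.
  rewrite expr_div_n -!exprM ![(_ * p ^ w)%N]mulnC !exprM.
  by rewrite (prim_expr_order prim_W) !expr1n divr1.
rewrite -subr_eq0 -[1](@divff _ (W ^+ j)) ?nzW // -mulrBl mulf_neq0 //.
  by rewrite subr_eq0 (eq_prim_root_expr prim_W) neij.
by rewrite invr_eq0 nzW.
Qed.

(** Project onto the class first. At level [s], the root of unity of exponent [i - j] lies in [K]
    and multiplication by it suffices. At a lower level, which is [logn p j + k], an element of [G]
    carries [z ^+ j] to [z ^+ i]. *)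
Lemma class_transport i j : (i = j %[mod p ^ level j])%N ->
  exists2 f : M -> M, is_galop K F f &
    [/\ forall l, int_adjoin z (f (z ^+ l)),
        forall l, (l != j %[mod p ^ level j])%N -> f (z ^+ l) = 0
      & f (z ^+ j) = z ^+ i].
Proof.
have [e ope De] := class_projector j.
move=> eij; have [lej|] := leqP s (level j).
  have Dw : level j = s by apply/eqP; rewrite eqn_leq lej class_level_le.
  (* Modulo [N], [j * N.-1] is the opposite of [j], so the exponent stands for [i - j]. *)
  pose c := z ^+ (i + j * N.-1).
  exists (fun t => c * e t); first (apply: is_galop_scale => //).
    apply: mem_relative_base; rewrite /dvdn -modnDml -Dw eij modnDml -mulnS prednK //.
    by rewrite -/(dvdn _ _) dvdn_mull // Dw dvdn_exp2l ?leq_addl.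
  split=> [l|l nlj|]; rewrite De.
  - apply: int_adjoinM; first exact: int_adjoin_root_exp.
    by case: ifP => _; [apply: int_adjoin_root_exp | apply: (int_adjoin_int _ 0)].
  - by rewrite (negPf nlj) mulr0.
  rewrite eqxx /c -exprD -addnA -mulnSr prednK // mulnC exprD exprM.
  by rewrite (prim_expr_order prim_z) expr1n mulr1.
move=> ltw.
have [dvj|dvj] := boolP (p ^ s %| j)%N.
  by move: ltw; rewrite /class_level dvj ltnn.
have j_gt0 : (0 < j)%N by rewrite lt0n; apply: contraNneq dvj => ->; rewrite dvdn0.
have Dw : level j = (logn p j + k)%N.
  by move: ltw; rewrite /class_level (negPf dvj); clear; lia.
set v := logn p j in Dw; set u := (j %/ p ^ v)%N.
have [t Dt] : exists t, (i + j * N.-1 = p ^ (v + k) * t)%N.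
  have: (p ^ (v + k) %| i + j * N.-1)%N.
    rewrite -Dw /dvdn -modnDml eij modnDml -mulnS prednK //.
    by rewrite -/(dvdn _ _) dvdn_mull // dvdn_exp2l // (leq_trans (ltnW ltw)) ?leq_addl.
  by case/dvdnP=> t Dt; exists t; rewrite Dt mulnC.
have [u' Du'] : exists u', (u * u' = 1 %[mod N])%N.
  have co_u : coprime u N by rewrite coprime_sym coprime_pexpl ?unitp_coprime.
  exists (u ^ (totient N).-1)%N; rewrite -expnS prednK ?totient_gt0 //.
  exact: Euler_exp_totient.
(* As [j = p ^ v * u], the correction [p ^ k * (t * u') * j] is [p ^ (v + k) * t] modulo [N], that
   is, [i - j]. *)
have [|g Gg gz] := @gal_relative_exists (1 + p ^ k * (t * u')).
  by rewrite addnC mulnC modnMDl.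
have gzj : g (z ^+ j) = z ^+ i.
  rewrite rmorphXn /= gz -exprM; apply/eqP; rewrite (eq_prim_root_expr prim_z).
  have -> : ((1 + p ^ k * (t * u')) * j = j + p ^ (v + k) * t * (u * u'))%N.
    by rewrite mulnDl mul1n -{2}(unitpK p j) -/v -/u expnD; congr addn; clear; nia.
  rewrite -modnDmr -modnMmr Du' modnMmr muln1 modnDmr -Dt addnCA -mulnS prednK //.
  by rewrite addnC modnMDl.
exists (fun t => g (e t)); first exact: is_galop_comp_gal.
split=> [l|l nlj|]; rewrite De.
- case: ifP => _; last by rewrite rmorph0; apply: (int_adjoin_int _ 0).
  by rewrite rmorphXn /= gz; do 2!apply: int_adjoinX; apply: int_adjoin_gen.
- by rewrite (negPf nlj) rmorph0.
by rewrite eqxx.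
Qed.

Section Generator.

Variable X : {set 'I_N}.
Hypothesis X_cover :
  forall j, exists2 i : 'I_N, i \in X & (i = j %[mod p ^ level j])%N.
Hypothesis X_inj :
  {in X &, forall i j : 'I_N, (i = j %[mod p ^ level j])%N -> i = j}.

Definition class_sum := \sum_(i in X) z ^+ i.

(** Transport from the representative of the class of [l] kills the other terms of [class_sum],
    which lie in other classes. *)
Lemma class_sum_basis l : exists2 f : M -> M, is_galop K F f &
  (forall i, int_adjoin z (f (z ^+ i))) /\ f class_sum = z ^+ l.
Proof.
have [r Xr erl] := X_cover l.
have [] := @class_transport l r; first by rewrite (class_level_eq p_pr _ erl).
move=> f opf [Zf f0 fr]; exists f => //; split=> //.
have [a Ka Df] := opf.
rewrite Df ?rpred_sum // /class_sum galop_sum (bigD1 r) //= -Df // fr.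
rewrite big1 ?addr0 // => i /andP[Xi nir]; rewrite -Df // f0 //.
by apply: contraNneq nir => /X_inj->.
Qed.

(** Expand [y] in powers of [z] and combine the operators of [class_sum_basis] with the same integer
    coefficients. Each of them preserves Z[z], hence so does the combination. *)
Lemma class_sum_generates y : y \in F -> integralOver intr y ->
  exists2 a : gal_of F -> M, (forall g, a g \in K) &
    galop K a class_sum = y /\
    (forall t, t \in F -> integralOver intr t -> integralOver intr (galop K a t)).
Proof.
move=> Fy inty; have [q Dq] := int_adjoinP (integral_cyclotomic p_pr prim_z' Fy inty).
have Fsum : class_sum \in F by rewrite rpred_sum.
have intz := integral_prim_root prim_z'.
have /fin_all_exists2[f opf hf] (l : 'I_(size q)) := class_sum_basis l.
have [a Ka Da] : is_galop K F (fun x => \sum_(l < size q) (q`_l)%:~R * f l x).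
  by apply: is_galop_sum => l; apply: is_galop_scale => //; apply: rpred_int.
exists a => //; split=> [|t Ft intt].
  by rewrite -Da // Dq; apply: eq_bigr => l _; have [_ ->] := hf l.
have [r ->] := int_adjoinP (integral_cyclotomic p_pr prim_z' Ft intt).
apply: (integral_int_adjoin intz); rewrite galop_sum.
apply: int_adjoin_sum => i _; rewrite galopMint.
apply: int_adjoinM; first exact: int_adjoin_int.
rewrite -Da //; apply: int_adjoin_sum => l _.
by apply: int_adjoinM; [apply: int_adjoin_int | have [] := hf l].
Qed.

(** The operator commutes with those producing the powers of [z] from [class_sum], so it kills all
    of [F]; linear independence of automorphisms concludes. *)
Lemma class_sum_free (a : gal_of F -> M) :
    (forall g, g \in G -> a g \in K) -> galop K a class_sum = 0 ->
  forall g, g \in G -> a g = 0.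
Proof.
move=> Ka a0; have Fsum : class_sum \in F by rewrite rpred_sum.
have az l : galop K a (z ^+ l) = 0.
  have [f [b Kb Df] [_ <-]] := class_sum_basis l.
  rewrite Df // (galopC sKF (gal_cyclotomicC prim_z') Fsum Ka Kb).
  rewrite a0; apply: big1 => g _; by rewrite rmorph0 mulr0.
apply: gal_independent => _ /Fadjoin1_polyP[P ->].
rewrite horner_coef -/(galop K a _) galop_sum big1 // => i _.
rewrite coef_map galopMfix ?az ?mulr0 // => g _.
by rewrite /= linearZ /= rmorph1.
Qed.

End Generator.

End RelativeCyclotomic.

(** * Descent along an extension of degree prime to p *)

Section Descent.

Variables (M : splittingFieldType rat) (p k' s : nat) (z : M).
Hypothesis p_pr : prime p.

Local Notation k := k'.+1.
Local Notation N := (p ^ (k + s))%N.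

Hypothesis prim_z : N.-primitive_root z.

Local Notation F := <<1%AS; z>>%AS.
Local Notation F0 := <<1%AS; z ^+ (p ^ s)>>%AS.
Local Notation G := 'Gal(F / F0)%g.

Variables K L : {subfield M}.
Hypotheses (sKL : (K <= L)%VS) (sLF : (L <= F)%VS) (sKF0 : (K <= F0)%VS).
Hypothesis gal_exponent : forall d : gal_of F,
  d \in 'Gal(F / L)%g -> (d ^+ p.-1)%g = 1%g.
Hypothesis capF0L : forall c, c \in F0 -> c \in L -> c \in K.
Hypothesis gal_disjoint : forall g : gal_of F,
  g \in G -> {in L, forall t, g t = t} -> g = 1%g.
Hypothesis card_gal : #|'Gal(L / K)%g| = #|G|.

Let prim_z' : (p ^ (k' + s).+1).-primitive_root z. Proof. exact: prim_z. Qed.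
Let p_gt0 := prime_gt0 p_pr.
Let N_gt0 : (0 < N)%N. Proof. by rewrite expn_gt0 p_gt0. Qed.
Let sF0F := @sub_relative_cyclotomic M p s z.

Let galLF : galois L F.
Proof. exact: (galois_sub_cyclotomic p_pr prim_z'). Qed.
Let galKF : galois K F.
Proof. by apply: (galois_sub_cyclotomic p_pr prim_z') => //; apply: subv_trans sLF. Qed.
Let galKL : galois K L.
Proof. exact: (galois_sub_cyclotomic p_pr prim_z'). Qed.

Lemma gal_expr_prim_root (d : gal_of F) c n :
  d z = z ^+ c -> (d ^+ n)%g z = z ^+ (c ^ n).
Proof.
move=> dz; elim: n => [|n IHn]; first by rewrite expg0 gal_id expr1.
rewrite expgSr galM ?memv_adjoin // IHn rmorphXn /= dz -exprM expnS //.
Qed.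

(** An element of Gal(F / L) sends [z] to [z ^+ c] with [c ^ p.-1 = 1] modulo [N], so it only
    permutes the terms of the sum. *)
Lemma class_sum_mem (X : {set 'I_N}) :
  (forall c, (c ^ p.-1 = 1 %[mod N])%N ->
    {in X, forall i : 'I_N, exists2 j : 'I_N, j \in X & (j = c * i %[mod N])%N}) ->
  class_sum z X \in L.
Proof.
move=> stX; rewrite -(galois_fixedField galLF).
apply/fixedFieldP; first by rewrite rpred_sum // => i _; rewrite rpredX ?memv_adjoin.
move=> d Gd; have [c co_c dz] := gal_prim_root prim_z' d.
have c1 : (c ^ p.-1 = 1 %[mod N])%N.
  apply/eqP; rewrite -(eq_prim_root_expr prim_z) -(gal_expr_prim_root _ dz).
  by rewrite gal_exponent // gal_id expr1.
pose J (i : 'I_N) : 'I_N := Ordinal (ltn_pmod (c * i) N_gt0).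
have XJ i : i \in X -> J i \in X.
  move=> Xi; have [j Xj ej] := stX c c1 i Xi.
  suff -> : J i = j by [].
  by apply/val_inj; rewrite /= -ej modn_small.
have injJ : injective J.
  move=> i j /(congr1 val) /= /eqP.
  rewrite -(eq_prim_root_expr prim_z) !exprM -dz => e.
  apply/val_inj/eqP; move: e; rewrite -!rmorphXn /= (inj_eq (fmorph_inj d)).
  by rewrite (eq_prim_root_expr prim_z) !modn_small.
have DX : J @: X = X.
  apply/eqP; rewrite eqEcard card_imset // leqnn andbT.
  by apply/subsetP=> _ /imsetP[i Xi ->]; apply: XJ.
rewrite rmorph_sum /class_sum -[in RHS]DX big_imset /=; last exact: in2W.
apply: eq_bigr => i _; rewrite rmorphXn /= dz -exprM.
by rewrite (prim_expr_mod prim_z).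
Qed.

Lemma gal_relative_base (d : gal_of F) c : c \in F0 -> d c \in F0.
Proof.
case/Fadjoin1_polyP=> P ->; rewrite -horner_map /= -map_poly_comp.
have [e _ dz] := gal_prim_root prim_z' d.
rewrite (eq_map_poly (g := in_alg M)); last first.
  by move=> q /=; rewrite linearZ /= rmorph1.
rewrite rmorphXn /= dz -exprM mulnC exprM.
rewrite horner_coef rpred_sum // => i _.
rewrite coef_map; apply: rpredM; first exact/rpredZ/mem1v.
by do 2!apply: rpredX; apply: memv_adjoin.
Qed.

(** Restriction to [L]. Outside Gal(L / K) [subg] gives a default value; [restrE] shows that this
    does not happen on [G]. *)
Let restr (g : gal_of F) : subg_of 'Gal(L / K)%G :=
  subg _ (normalField_cast L g).

Let GK g : g \in G -> g \in 'Gal(F / K)%g.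
Proof. by move=> Gg; apply: subsetP Gg; apply: galS. Qed.

Let restrE g : g \in G -> {in L, sgval (restr g) =1 g}.
Proof.
move=> Gg t Lt; have [_ _ nKL] := and3P galKL.
have castE : {in L, normalField_cast L g =1 g}.
  by apply: (normalField_cast_eq _ nKL (GK Gg)); rewrite sKL.
rewrite /restr subgK ?castE //.
rewrite gal_kHom //; apply/kAHomP=> c Kc; rewrite castE ?(subvP sKL) //.
exact: fixed_gal sF0F Gg (subvP sKF0 _ Kc).
Qed.

Let restr_inj : {in G &, injective restr}.
Proof.
move=> g h Gg Gh e; apply/eqP; rewrite eq_mulgV1; apply/eqP.
apply: gal_disjoint => [|t Lt]; first by rewrite groupM ?groupV.
have Ft := subvP sLF t Lt.
rewrite galM // -(restrE Gg Lt) e (restrE Gh Lt) -galM // mulgV gal_id //.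
Qed.

Let restr_img : restr @: G = setT.
Proof.
apply/eqP; rewrite eqEcard subsetT card_in_imset // -card_gal.
rewrite -(card_imset [set: _] (@val_inj _ _ (subg_of 'Gal(L / K)%G))).
apply: subset_leq_card.
by apply/subsetP=> _ /imsetP[h _ ->]; apply: subgP.
Qed.

Let restr_surj h : exists2 g, g \in G & h = restr g.
Proof. by apply/imsetP; rewrite restr_img inE. Qed.

(** Reads elements of the group algebra of [L / K] as operators of [F / F0], to which the results on
    [class_sum] apply. *)
Let ga_actE (A : group_algebra K L) t : t \in L ->
  ga_act A t = galop F0 (fun g : gal_of F => vsval (A (restr g))) t.
Proof.
move=> Lt; transitivity (\sum_(h in [set: subg_of 'Gal(L / K)%G])
    vsval (A h) * (sgval h : gal_of L) t); first by apply: eq_bigl => h; rewrite inE.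
rewrite -restr_img big_imset //=.
by apply: eq_bigr => g Gg; rewrite restrE.
Qed.

Lemma leopoldt_descent : leopoldt K L.
Proof.
have [X [X_cover X_inj stX]] := class_representatives p_pr s (ltn0Sn k').
pose x := class_sum z X.
have Lx : x \in L by apply: class_sum_mem.
have intx : integralOver (intr : int -> M) x.
  by apply: integral_sum => i _; apply/integral_exp/(integral_prim_root prim_z').
have free := class_sum_free p_pr prim_z X_cover X_inj.
have gen := class_sum_generates p_pr prim_z X_cover X_inj.
exists 1%N, (fun=> x); split=> [_ //|y [Ly inty]].
have [a F0a [ax_y a_int]] := gen y (subvP sLF y Ly) inty.
(* Applying [d] in Gal(F / L) to [ax_y] fixes [x] and [y] and moves the coefficients within [F0];
   freeness then makes each coefficient invariant under [d]. *)
have Ka g : g \in G -> a g \in K.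
  move=> Gg; apply: (capF0L (F0a g)); rewrite -(galois_fixedField galLF).
  apply/fixedFieldP=> [|d Gd]; first exact: (subvP sF0F).
  apply/eqP; rewrite -subr_eq0; apply/eqP.
  apply: (free (fun h => d (a h) - a h)) => // [h _|].
    by apply: rpredB; [apply: gal_relative_base |]; apply: F0a.
  rewrite (galopB F0 (fun h => d (a h))) ax_y; apply/eqP; rewrite subr_eq0; apply/eqP.
  rewrite -[RHS](fixed_gal sLF Gd Ly) -ax_y rmorph_sum; apply: eq_bigr => h Gh.
  have Fx := subvP sLF x Lx.
  rewrite rmorphM; congr (_ * _).
  rewrite -/x /= -galM // (gal_cyclotomicC prim_z') galM //.
  by rewrite (fixed_gal sLF Gd Lx).
have /fin_all_exists2[lift Glift liftE] := restr_surj.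
have restrK g : g \in G -> lift (restr g) = g.
  by move=> Gg; apply: restr_inj => //; rewrite -liftE.
pose A : group_algebra K L := [ffun h => vsproj K (a (lift h))].
have actA t : t \in L -> ga_act A t = galop F0 a t.
  move=> Lt; rewrite ga_actE //; apply: eq_bigr => g Gg.
  by rewrite ffunE restrK // vsprojK ?Ka.
exists [ffun=> A]; split=> [|B [_ By]].
  split=> [i|]; last by rewrite big_ord1 ffunE actA.
  rewrite ffunE => t [Lt intt]; split.
    rewrite /ga_act rpred_sum // => h _.
    by rewrite rpredM ?memv_gal // (subvP sKL) ?subvsP.
  by rewrite actA //; apply: a_int => //; apply: (subvP sLF).
(* For uniqueness, the difference of two solutions is an operator of [F / F0] killing [x]. *)
apply/ffunP=> i; rewrite ffunE ord1; apply/ffunP=> h.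
have [g Gg ->] := restr_surj h; apply/val_inj/eqP; rewrite -subr_eq0; apply/eqP.
rewrite big_ord1 in By.
apply: (free (fun g => vsval (A (restr g)) - vsval (B 0 (restr g)))) => // [g' _|].
  by rewrite rpredB // (subvP sKF0) ?subvsP.
rewrite (galopB F0 (fun g => vsval (A (restr g)))) -/x.
by rewrite -!ga_actE // -By actA // ax_y subrr.
Qed.

End Descent.

(** * Subfields of a cyclotomic field of prime power order *)

Lemma expn_1D_trunc x n :
  exists q, ((1 + x) ^ n = 1 + n * x + 'C(n, 2) * x ^ 2 + q * x ^ 3)%N.
Proof.
elim: n => [|n [q IHn]]; first by exists 0%N; rewrite bin0n.
exists ('C(n, 2) + q * (1 + x))%N; rewrite expnSr IHn binS bin1.
by rewrite !expnS expn0; ring.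
Qed.

(** In raising [1 + p ^ i.+1 * y] to the power [p], only the linear term counts modulo [p ^ i.+3]:
    the quadratic one carries ['C(p, 2)], divisible by [p] because [p] is odd. *)
Lemma expn_1D_prime p i : prime p -> odd p ->
  exists t, ((1 + p) ^ (p ^ i) = 1 + p ^ i.+1 * (1 + p * t))%N.
Proof.
move=> p_pr p_odd; elim: i => [|i [t IHi]].
  by exists 0%N; rewrite muln0 muln1 !expn1.
rewrite expnSr expnM IHi; set y := (1 + p * t)%N.
have [q ->] := expn_1D_trunc (p ^ i.+1 * y) p.
have /dvdnP[c ->] : (p %| 'C(p, 2))%N.
  by apply: prime_dvd_bin => //; apply: odd_prime_gt2.
exists (t + p ^ i * c * y ^ 2 + q * p ^ i * p ^ i * y ^ 3)%N.
rewrite mulnDr !mulnDr !expnS !expn0 /y; ring.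
Qed.

Section CyclotomicSubfields.

Variables (M : splittingFieldType rat) (p n : nat) (z : M).
Hypotheses (p_pr : prime p) (p_odd : odd p).
Hypothesis prim_z : (p ^ n.+1).-primitive_root z.

Local Notation E := <<1%AS; z>>%AS.
Local Notation Ea a := <<1%AS; z ^+ (p ^ a)>>%AS.

Let p_gt0 := prime_gt0 p_pr.
Let p_gt1 := prime_gt1 p_pr.

Lemma prim_root_exp_prime a :
  (a <= n)%N -> (p ^ (n - a).+1).-primitive_root (z ^+ (p ^ a)).
Proof.
move=> lean; have -> : (p ^ a = p ^ n.+1 %/ p ^ (n - a).+1)%N.
  by rewrite -subSn // -expnB ?subKn ?leq_subr // ?p_gt0 // ltnW.
by apply: dvdn_prim_root => //; rewrite dvdn_exp2l // ltnS leq_subr.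
Qed.

Let sEaE a : (Ea a <= E)%VS.
Proof. by apply/FadjoinP; split; [apply: sub1v | rewrite rpredX ?memv_adjoin]. Qed.

Lemma card_gal_cyclotomic a : (a <= n)%N -> #|'Gal(E / Ea a)%g| = (p ^ a)%N.
Proof.
move=> lean; rewrite -galois_dim; last first.
  by apply: galoisS (galois_cyclotomic p_pr prim_z); rewrite sub1v sEaE.
rewrite (dim_cyclotomic p_pr prim_z) (dim_cyclotomic p_pr (prim_root_exp_prime lean)).
rewrite !totient_pfactor //= -{1}(subnK lean) expnD mulnA mulKn //.
by rewrite muln_gt0 expn_gt0 p_gt0 -ltnS prednK // p_gt1.
Qed.

(** Sending [z] to [z ^+ (1 + p)] gives a generator: by [expn_1D_prime], [(1 + p) ^ (p ^ m)] is 1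
    modulo [p ^ n.+1] only if [n <= m], and the group has order [p ^ n]. *)
Lemma cyclic_gal_cyclotomic : cyclic 'Gal(E / Ea n)%g.
Proof.
have [|g Gg gz] := @gal_relative_exists M p 0 n z p_pr prim_z (1 + p).
  by rewrite expn1 modnDr.
apply/cyclicP; exists g; apply/eqP; rewrite eq_sym eqEcard cycle_subG Gg /=.
rewrite card_gal_cyclotomic // -orderE.
have /(dvdn_pfactor _ _ p_pr)[m lemn Dm] : (#[g]%g %| p ^ n)%N.
  by rewrite -(card_gal_cyclotomic (leqnn n)) order_dvdG.
rewrite Dm leq_exp2l //.
have := expg_order g; rewrite Dm => gm1.
have := gal_expr_prim_root (p ^ m) gz; rewrite gm1 gal_id => /esym/eqP.
rewrite -{2}[z]expr1 (eq_prim_root_expr prim_z).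
have [t ->] := expn_1D_prime m p_pr p_odd.
rewrite eqn_mod_dvd ?leq_addr // addKn Gauss_dvdl.
  by rewrite dvdn_Pexp2l.
rewrite coprime_pexpl // addnC mulnC /coprime gcdnMDl gcdn1 //.
Qed.

(** A subgroup of a cyclic group is determined by its order, and the fields [Ea a] realise every
    divisor of [p ^ n]. *)
Lemma cyclotomic_subfieldP (F : {subfield M}) :
    z ^+ (p ^ n) \in F -> (F <= E)%VS ->
  exists2 a, (a <= n)%N & F = Ea a.
Proof.
move=> Fz sFE; have sEF : (Ea n <= F)%VS by apply/FadjoinP; rewrite sub1v.
have := cardSg (galS E sEF); rewrite card_gal_cyclotomic //.
case/(dvdn_pfactor _ _ p_pr)=> a lean Da; exists a => //.
have galE (A : {subfield M}) : (A <= E)%VS -> galois A E.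
  by move=> sAE; apply: galoisS (galois_cyclotomic p_pr prim_z); rewrite sub1v.
have sEaEn : (Ea n <= Ea a)%VS.
  apply/FadjoinP; split; first exact: sub1v.
  by rewrite -(subnKC lean) expnD exprM rpredX ?memv_adjoin.
have /eqP eqG : 'Gal(E / F)%g == 'Gal(E / Ea a)%g.
  by rewrite (eq_subG_cyclic cyclic_gal_cyclotomic) ?galS // Da card_gal_cyclotomic.
apply/val_inj => /=; rewrite -(galois_fixedField (galE _ sFE)) eqG.
exact: (galois_fixedField (galE _ (sEaE a))).
Qed.

End CyclotomicSubfields.

(** * Adjoining a primitive p-th root of unity *)

Section AdjoinPrimeRoot.

Variables (M : splittingFieldType rat) (p : nat) (w : M) (K : {subfield M}).
Hypotheses (p_pr : prime p) (prim_w : p.-primitive_root w).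

Local Notation F := <<K; w>>%AS.

Lemma gal_adjoin_prime_root (d : gal_of F) :
  d \in 'Gal(F / K)%g -> (d ^+ p.-1)%g = 1%g.
Proof.
move=> Gd; apply/eqP; rewrite gal_adjoin_eq ?groupX ?group1 // gal_id.
have prim_dw : p.-primitive_root (d w) by rewrite fmorph_primitive_root.
have [c Dc] := prim_rootP prim_w (prim_expr_order prim_dw).
have co_c : coprime c p by rewrite -(prim_root_exp_coprime _ prim_w) -Dc.
have dn i : (d ^+ i)%g w = w ^+ (c ^ i).
  elim: i => [|i IHi]; first by rewrite expg0 gal_id expr1.
  by rewrite expgSr galM ?memv_adjoin // IHi rmorphXn /= Dc -exprM expnS.
rewrite dn -{2}[w]expr1 (eq_prim_root_expr prim_w) -totient_prime //.
by rewrite Euler_exp_totient.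
Qed.

(** Otherwise Cauchy's theorem would give an automorphism of order [p], while all orders divide
    [p.-1]. *)
Lemma coprime_adjoin_prime_root : galois K F -> coprime p (\dim_K F).
Proof.
move=> galKF; rewrite galois_dim // prime_coprime //; apply/negP.
case/(Cauchy p_pr) => d Gd od.
have : (#[d]%g %| p.-1)%N by rewrite order_dvdn gal_adjoin_prime_root.
by rewrite od gtnNdvd // -ltnS prednK ?prime_gt0 ?prime_gt1.
Qed.

End AdjoinPrimeRoot.

Theorem theorem1p2 (p r s : nat) (M : splittingFieldType rat) (zeta : M)
    (K L : {subfield M})
    (p_prime : prime p) (p_odd : odd p) (r_ge1 : (1 <= r)%N) (s_ge1 : (1 <= s)%N)
    (zeta_prim : (p ^ (r + s))%N.-primitive_root zeta)
    (sub_KL : (K <= L)%VS) (deg_KL : \dim_K L = (p ^ s)%N)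
    (sub_L_cyclo : (L <= <<1%VS; zeta>>)%VS) :
  leopoldt K L.
Proof.
have p_gt0 := prime_gt0 p_prime; have p_gt1 := prime_gt1 p_prime.
have [n Dn] : exists n, (r + s = n.+1)%N.
  by exists (r + s).-1; rewrite prednK // addn_gt0 r_ge1.
rewrite {}Dn in zeta_prim.
pose E := <<1%AS; zeta>>%AS; have sLE : (L <= E)%VS := sub_L_cyclo.
have sKE := subv_trans sub_KL sLE.
pose w := zeta ^+ (p ^ n).
have Ew : w \in E by rewrite rpredX ?memv_adjoin.
have prim_w : p.-primitive_root w.
  by have := prim_root_exp_prime p_prime zeta_prim (leqnn n); rewrite subnn expn1.
have sLwE : (<<L; w>> <= E)%VS by apply/FadjoinP.
have sKwE : (<<K; w>> <= E)%VS by apply/FadjoinP.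
have [a lean DF] :=
  cyclotomic_subfieldP p_prime p_odd zeta_prim (memv_adjoin L w) sLwE.
have [b lebn DF0] :=
  cyclotomic_subfieldP p_prime p_odd zeta_prim (memv_adjoin K w) sKwE.
have sKLw : (<<K; w>> <= <<L; w>>)%VS.
  by apply/FadjoinP; split; [apply: subv_trans (subv_adjoin L w) | apply: memv_adjoin].
have eqF : <<L; w>>%VS = <<1%AS; zeta ^+ (p ^ a)>>%VS := congr1 asval DF.
have eqF0 : <<K; w>>%VS = <<1%AS; zeta ^+ (p ^ b)>>%VS := congr1 asval DF0.
have leab : (a <= b)%N.
  have sab : (<<1%AS; zeta ^+ (p ^ b)>>%AS <= <<1%AS; zeta ^+ (p ^ a)>>%AS)%VS.
    by rewrite /= -eqF -eqF0.
  have := cardSg (galS E sab).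
  rewrite (card_gal_cyclotomic p_prime zeta_prim lean).
  by rewrite (card_gal_cyclotomic p_prime zeta_prim lebn) dvdn_Pexp2l.
pose z := zeta ^+ (p ^ a).
have zs : zeta ^+ (p ^ b) = z ^+ (p ^ (b - a)) by rewrite -exprM -expnD subnKC.
have prim_z' : (p ^ (n - a).+1).-primitive_root z.
  exact: (prim_root_exp_prime p_prime zeta_prim lean).
have prim_z : (p ^ ((n - b).+1 + (b - a))).-primitive_root z.
  by have -> : ((n - b).+1 + (b - a) = (n - a).+1)%N by clear -leab lebn; lia.
have card_gal : #|'Gal(<<1%AS; z>>%AS / <<1%AS; z ^+ (p ^ (b - a))>>%AS)%g| =
    (p ^ (b - a))%N.
  by apply: (card_gal_cyclotomic p_prime prim_z'); rewrite leq_sub2r.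
have galKw := galois_sub_cyclotomic p_prime zeta_prim (subv_adjoin K w) sKwE.
have galLw := galois_sub_cyclotomic p_prime zeta_prim (subv_adjoin L w) sLwE.
have galKL := galois_sub_cyclotomic p_prime zeta_prim sub_KL sLE.
have galF := galois_sub_cyclotomic p_prime zeta_prim sKLw sLwE.
have coK := coprime_adjoin_prime_root p_prime prim_w galKw.
have dimF : \dim_<<K; w>> <<L; w>> = (p ^ (b - a))%N.
  by rewrite -card_gal -galois_dim /= -zs -eqF -eqF0.
(* Compare p-adic valuations in the two towers from [K] to [<<L; w>>]: the degrees of [<<L; w>>]
   over [L] and of [<<K; w>>] over [K] are prime to [p]. *)
have Dba : (b - a = s)%N.
  have [dL coL DL] : exists2 d, coprime p d & \dim <<L; w>> = (d * \dim L)%N.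
    exists (\dim_L <<L; w>>); last exact: dim_sup_field (subv_adjoin L w).
    exact: (coprime_adjoin_prime_root p_prime prim_w galLw).
  have [dK {}coK DK] : exists2 d, coprime p d & \dim <<K; w>> = (d * \dim K)%N.
    by exists (\dim_K <<K; w>>); last exact: dim_sup_field (subv_adjoin K w).
  have := dim_sup_field sKLw; rewrite dimF DL DK (dim_sup_field sub_KL) deg_KL.
  rewrite !mulnA => /eqP; rewrite eqn_pmul2r ?adim_gt0 // => /eqP.
  move/(congr1 (logn p)).
  have pos d : coprime p d -> (0 < d)%N.
    by case: d => //; rewrite /coprime gcdn0 gtn_eqF.
  rewrite !lognM ?expn_gt0 ?p_gt0 ?pos //.
  by rewrite !pfactorK // !logn_coprime // addn0.
rewrite Dba in zs prim_z card_gal.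
rewrite zs in DF0.
apply: (leopoldt_descent p_prime prim_z) => //.
- by rewrite -DF subv_adjoin.
- by rewrite -DF0 subv_adjoin.
- by rewrite -DF; apply: gal_adjoin_prime_root.
(* The degree of [A] over [K] divides both [p ^ s] and the degree of [<<K; w>>] over [K], which is
   prime to [p]. *)
- rewrite -DF0 => c F0c Lc; pose A := (<<K; w>> :&: L)%AS.
  have dim_tower (B C : {subfield M}) : (K <= B)%VS -> (B <= C)%VS ->
      (\dim_K B %| \dim_K C)%N.
    move=> sKB sBC; rewrite -(dvdn_pmul2r (adim_gt0 K)) -!dim_sup_field //.
      exact: field_dimS.
    exact: subv_trans sBC.
  have sKA : (K <= A)%VS by rewrite subv_cap subv_adjoin.
  have dvL : (\dim_K A %| p ^ s)%N by rewrite -deg_KL dim_tower // capvSr.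
  have dvF0 : (\dim_K A %| \dim_K <<K; w>>)%N.
    by apply: (dim_tower A <<K; w>>%AS) => //; apply: capvSl.
  have dim1 : \dim_K A = 1%N.
    apply/eqP; rewrite -dvdn1 -(eqnP (coprimeXl s coK)) dvdn_gcd dvL.
    exact: dvF0.
  suff <- : (A : {vspace M}) = K by rewrite memv_cap F0c.
  by apply/eqP; rewrite eq_sym eqEdim sKA (dim_sup_field sKA) dim1 mul1n /=.
(* [g] fixes [L] pointwise, and also [w], which lies in [<<K; w>>]. *)
- rewrite -DF -DF0 => g Gg Lg; apply/eqP.
  have GLg : g \in 'Gal(<<L; w>>%AS / L)%g.
    by rewrite gal_kHom ?subv_adjoin //; apply/kAHomP.
  rewrite gal_adjoin_eq ?group1 // gal_id.
  by rewrite (fixed_gal _ Gg) ?memv_adjoin.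
by rewrite -galois_dim // deg_KL card_gal.
Qed.
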